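(* Let $A\in\mathbb{R}$ be such that the bilinear form $$[p,q]_2=\int_{-\infty}^\infty\frac{p(x)q(x)-(pq)(0)-(pq)'(0)\,x}{x^2}\,e^{-x^2}dx-2\sqrt{\pi}\,p(0)q(0)+A\,p'(0)q'(0)$$ on polynomials has a sequence of monic orthogonal polynomials $(\mathcal{S}_n)_{n\ge0}$, and let $\lambda_n$ ($n\ge2$) be the numbers for which $\mathcal{S}_n=H_n+\lambda_nH_{n-2}$. Then for $n\ge2$ the polynomial $\mathcal{S}_n$ satisfies the second-order differential equation $$x\mathcal{S}_n''(x)-2x^2\Big(1+\frac{2\lambda_n}{\mathcal{R}(x,n)}\Big)\mathcal{S}_n'(x)+2\Big(\frac{n\mathcal{B}(x,n)-(n-2)\lambda_n\mathcal{A}(x,n)}{\mathcal{R}(x,n)}\Big)x\,\mathcal{S}_n(x)=0,$$ where $$\mathcal{A}(x,n)=n-2\lambda_n,\qquad\mathcal{B}(x,n)=\frac{n(n-1)}2+(2x^2-n+1)\lambda_n,\qquad\mathcal{R}(x,n)=\mathcal{B}(x,n)-\lambda_n\mathcal{A}(x,n).$$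
   Context: $H_n$ are the monic Hermite polynomials (orthogonal with respect to $e^{-x^2}dx$ on $\mathbb{R}$), with $xH_n=H_{n+1}+\frac n2H_{n-1}$. A sequence of monic orthogonal polynomials for a bilinear form $[\cdot,\cdot]$ is a sequence of monic polynomials $(\mathcal{S}_n)_{n\ge0}$ with $\deg\mathcal{S}_n=n$ and $[\mathcal{S}_n,\mathcal{S}_k]=K_n\delta_{n,k}$, $K_n\neq0$. Each $\mathcal{S}_n$ ($n\ge2$) is of the form $H_n+\lambda_nH_{n-2}$ for a unique number $\lambda_n$. The differential equation is understood as an identity of rational functions in $x$. *)

(* Defs.v *)
From mathcomp Require Import all_boot all_order all_algebra.
From mathcomp Require Import all_classical all_reals all_analysis measurable_realfun.
From mathcomp Require Import ring.

Set Implicit Arguments.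
Unset Strict Implicit.
Unset Printing Implicit Defensive.

Import Order.TTheory GRing.Theory Num.Theory.
Import numFieldNormedType.Exports.

Local Open Scope ring_scope.

Definition is_monic_ops (R : realType) (form : {poly R} -> {poly R} -> R)
    (S : nat -> {poly R}) : Prop :=
  (forall n, S n \is monic /\ size (S n) = n.+1) /\
  exists K : nat -> R, (forall n, K n != 0) /\
    forall n k, form (S n) (S k) = if n == k then K n else 0.

(* [gauss_fun x] is [expR (- x ^+ 2)]. *)
Definition gauss_form (R : realType) (p q : {poly R}) : R :=
  \int[lebesgue_measure]_x (p.[x] * q.[x] * gauss_fun x).

(* The monic orthogonal polynomials for [expR (- x ^+ 2)] (see [hermite_ops]),
   given by their three-term recurrence. *)
Fixpoint hermite (R : realType) (n : nat) : {poly R} :=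
  match n with
  | 0 => 1
  | m.+1 => match m with
            | 0 => 'X
            | k.+1 => 'X * hermite R m - (m%:R / 2) *: hermite R k
            end
  end.

(* The integrand of the first term has a removable singularity at [0]; there
   the total division returns [0], which does not affect the integral. *)
Definition form2 (R : realType) (A : R) (p q : {poly R}) : R :=
  \int[lebesgue_measure]_x
     ((p.[x] * q.[x] - (p * q).[0] - (p * q)^`().[0] * x) / x ^+ 2
        * gauss_fun x)
  - 2 * Num.sqrt pi * p.[0] * q.[0]
  + A * p^`().[0] * q^`().[0].

Definition odeA (R : realType) (l : R) (n : nat) : {poly R} :=
  (n%:R - 2 * l)%:P.

Definition odeB (R : realType) (l : R) (n : nat) : {poly R} :=
  (n%:R * (n%:R - 1) / 2)%:P + l *: (2 *: 'X^2 - n%:R%:P + 1).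

Definition odeR (R : realType) (l : R) (n : nat) : {poly R} :=
  odeB l n - l *: odeA l n.

Notation "p %:F" := (@FracField.tofrac _ p) : ring_scope.

(* The divisions by [odeR] in the differential equation are genuine. *)
Lemma odeR_neq0 (R : realType) (l : R) (n : nat) :
  (2 <= n)%N -> odeR l n != 0.
Proof.
move=> n2; have [->|l0] := eqVneq l 0.
  rewrite /odeR /odeB !scale0r subr0 addr0 polyC_eq0 -(natrB _ (ltnW n2)).
  by rewrite !mulf_neq0 ?invr_eq0 ?pnatr_eq0 -?lt0n ?subn_gt0 // (ltn_trans _ n2).
apply/eqP => /(congr1 (fun p : {poly R} => p`_2)).
rewrite /odeR /odeB /odeA !coefE /= !(addr0, subr0, mulr0, add0r, mulr1) => /eqP.
by rewrite mulf_eq0 (negPf l0) pnatr_eq0.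
Qed.

Local Open Scope classical_set_scope.

Lemma norm_expr_gauss_le (R : realType) (i : nat) (x : R) :
  `|x ^+ i| * gauss_fun x <= (1 + 2 ^+ i.+1 * (i.+1)`!%:R) * normal_fun 0 1 x.
Proof.
pose y := x ^+ 2 / 2.
have y0 : 0 <= y by rewrite mulr_ge0 ?sqr_ge0 ?invr_ge0.
have -> : normal_fun 0 1 x = expR (- y).
  by rewrite /normal_fun /y subr0 expr1n mulNr.
have -> : gauss_fun x = expR (- y) * expR (- y).
  by rewrite -expRD /gauss_fun /y; congr expR; field.
rewrite mulrA ler_wpM2r ?expR_ge0 // expRN ler_pdivrMr ?expR_gt0 //.
have h : x ^+ (2 * i.+1) <= 2 ^+ i.+1 * (i.+1)`!%:R * expR y.
  have -> : x ^+ (2 * i.+1) = 2 ^+ i.+1 * y ^+ i.+1.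
    by rewrite exprM -exprMn; congr (_ ^+ _); rewrite /y; field.
  rewrite -mulrA ler_pM2l ?exprn_gt0 // mulrC -ler_pdivrMr ?ltr0n ?fact_gt0 //.
  by apply: le_trans (expR_ge1Dxn i y0); rewrite lerDr.
have e1 : 1 <= expR y by rewrite -expR0 ler_expR.
have : `|x ^+ i| <= 1 + x ^+ (2 * i.+1).
  have [x1|x1] := leP `|x| 1.
    by rewrite normrX (@le_trans _ _ 1) ?exprn_ile1 // lerDl exprM exprn_ge0 ?sqr_ge0.
  have -> : x ^+ (2 * i.+1) = `|x| ^+ (2 * i.+1).
    by rewrite !exprM real_normK ?num_real.
  by rewrite normrX ler_wpDl // ler_eXn2l ?(leq_trans (leqnSn i)) ?leq_pmull.
move=> /le_trans; apply; rewrite mulrDl mul1r; exact: lerD.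
Qed.

Lemma norm_horner_gauss_le (R : realType) (p : {poly R}) :
  exists C : R, forall x, `|p.[x] * gauss_fun x| <= C * normal_fun 0 1 x.
Proof.
exists (\sum_(i < size p) `|p`_i| * (1 + 2 ^+ i.+1 * (i.+1)`!%:R)) => x.
rewrite normrM (ger0_norm (gauss_fun_ge0 x)) horner_coef.
apply: (le_trans (ler_wpM2r (gauss_fun_ge0 x) (ler_norm_sum _ _ _))).
rewrite !mulr_suml; apply: ler_sum => i _.
by rewrite normrM -!mulrA ler_wpM2l // norm_expr_gauss_le.
Qed.

Lemma continuous_horner_gauss (R : realType) (p : {poly R}) :
  continuous (fun x => p.[x] * gauss_fun x).
Proof.
by move=> x; apply: cvgM; [exact: continuous_horner|exact: continuous_gauss_fun].
Qed.

Lemma measurable_horner_gauss (R : realType) (p : {poly R}) :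
  measurable_fun [set: R] (fun x : R => p.[x] * gauss_fun x).
Proof.
apply: continuous_measurable_fun.
exact: continuous_horner_gauss.
Qed.

Lemma integrable_gauss_dom (R : realType) (C : R) :
  (@lebesgue_measure R).-integrable setT (fun x => (C * normal_fun 0 1 x)%:E).
Proof.
have o1 : (1 : R) != 0 by exact: oner_neq0.
have -> : (fun x => (C * normal_fun 0 1 x)%:E) =
          (fun x => (C / normal_peak 1)%:E * (normal_pdf 0 1 x)%:E)%E.
  apply/funext => x; rewrite -EFinM normal_pdfE // mulrA divfK //.
  by rewrite gt_eqF // normal_peak_gt0.
by apply: integrableZl => //; exact: integrable_normal_pdf.
Qed.

Lemma integrable_horner_gauss (R : realType) (p : {poly R}) :
  (@lebesgue_measure R).-integrable setT (fun x => (p.[x] * gauss_fun x)%:E).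
Proof.
have [C hC] := norm_horner_gauss_le p.
apply: (le_integrable measurableT _ _ (integrable_gauss_dom C)) => //.
  by apply/measurable_EFinP; exact: measurable_horner_gauss.
move=> x _; rewrite /= lee_fin (le_trans (hC x)) //; exact: ler_norm.
Qed.

Definition gauss_int (R : realType) (p : {poly R}) : R :=
  \int[lebesgue_measure]_x (p.[x] * gauss_fun x).

Lemma gauss_intD (R : realType) (p q : {poly R}) :
  gauss_int (p + q) = gauss_int p + gauss_int q.
Proof.
rewrite /gauss_int -RintegralD //; [|exact: integrable_horner_gauss..].
by apply: eq_Rintegral => x _; rewrite hornerD mulrDl.
Qed.

Lemma gauss_intZ (R : realType) c (p : {poly R}) :
  gauss_int (c *: p) = c * gauss_int p.
Proof.
rewrite /gauss_int -RintegralZl //; [|exact: integrable_horner_gauss..].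
by apply: eq_Rintegral => x _; rewrite hornerZ mulrA.
Qed.

Lemma gauss_int1 (R : realType) : gauss_int (1 : {poly R}) = Num.sqrt pi.
Proof.
rewrite /gauss_int /Rintegral -[RHS]/(fine (Num.sqrt pi)%:E) -integralT_gauss.
by congr fine; apply: eq_integral => x _; rewrite hornerC mul1r.
Qed.

Lemma is_derive_horner_gauss (R : realType) (p : {poly R}) (x : R) :
  is_derive x 1 (fun x => p.[x] * gauss_fun x)
    ((p^`() - 2 *: 'X * p).[x] * gauss_fun x).
Proof.
have -> : @gauss_fun R = expR \o horner (- 'X^2).
  by apply/funext => t; rewrite /gauss_fun /= hornerN hornerXn.
have h := is_derive1_comp (is_derive_expR (- 'X^2).[x]) (is_derive_poly (- 'X^2) x).
apply: (is_derive_eq (is_deriveM (is_derive_poly p x) h)).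
rewrite /= !hornerE derivN derivXn !hornerE /= /GRing.scale /=.
ring.
Qed.

Lemma gauss_ibp (R : realType) (p : {poly R}) :
  gauss_int (p^`() - 2 *: 'X * p) = 0.
Proof.
set q := p^`() - _; pose f x := q.[x] * gauss_fun x.
pose F x := p.[x] * gauss_fun x.
pose D (n : nat) : set R := `[(- n.+1%:R)%R, n.+1%:R].
pose f_ (n : nat) (x : R) : \bar R := ((fun x => (f x)%:E) \_ (D n)) x.
have [C hC] := norm_horner_gauss_le q.
have [] := @dominated_convergence _ _ R lebesgue_measure setT measurableT
  f_ (fun x => (f x)%:E) (fun x => (C * normal_fun 0 1 x)%:E).
- move=> n; apply/(measurable_restrictT _ _).1 => //.
    by rewrite /D; exact: measurable_itv.
  by apply: measurable_funTS; apply/measurable_EFinP; exact: measurable_horner_gauss.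
- by apply/measurable_EFinP; exact: measurable_horner_gauss.
- apply: aeW => x _; apply: cvg_near_cst; near=> n.
  rewrite /f_ /= patchT // inE /D /= in_itv /= -ler_norml.
  apply: (@le_trans _ _ n%:R); last by rewrite ler_nat.
  by near: n; exact: nbhs_infty_ger.
- exact: integrable_gauss_dom.
- apply: aeW => x n _; rewrite /f_ /patch; case: ifP => _.
    by rewrite lee_fin; exact: hC.
  by rewrite abse0 lee_fin (le_trans _ (hC x)).
move=> _ _ cvf.
have intf n : (\int[lebesgue_measure]_x f_ n x = (F n.+1%:R - F (- n.+1%:R))%:E)%E.
  rewrite -integral_mkcond EFinB; apply: continuous_FTC2.
  - by rewrite -subr_gt0 opprK addr_gt0 ?ltr0n.
  - apply: continuous_subspaceT; exact: continuous_horner_gauss.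
  - split.
    + by move=> x _; have [] := is_derive_horner_gauss p x.
    + by apply: cvg_at_right_filter; exact: continuous_horner_gauss.
    + by apply: cvg_at_left_filter; exact: continuous_horner_gauss.
  - by move=> x _; rewrite derive1E; have [_ ->] := is_derive_horner_gauss p x.
have [C' hC'] := norm_horner_gauss_le (p * 'X).
have F0 : (fun n : nat => F n.+1%:R - F (- n.+1%:R)) @ \oo --> (0 : R).
  have bF (x : R) : `|F x| * `|x| <= `|C'|.
    rewrite -normrM mulrAC -hornerMX (le_trans (hC' x)) //.
    rewrite (le_trans (ler_norm _)) // normrM ler_piMr // ger0_norm ?expR_ge0 //.
    rewrite /normal_fun -[leRHS]expR0 ler_expR mulNr oppr_le0.
    by rewrite mulr_ge0 ?sqr_ge0 ?invr_ge0 ?mulrn_wge0 ?exprn_ge0.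
  apply/cvgrPdist_le => e e0; near=> n.
  rewrite sub0r normrN (le_trans (ler_normB _ _)) //.
  have n0 : 0 < n.+1%:R :> R by rewrite ltr0n.
  have b (x : R) : `|x| = n.+1%:R -> `|F x| <= `|C'| / n.+1%:R.
    by move=> xn; rewrite ler_pdivlMr // -xn.
  apply: (le_trans (lerD (b _ _) (b _ _))); rewrite ?normrN ?normr_nat //.
  rewrite -mulrDl ler_pdivrMr // -ler_pdivrMl //.
  apply: (@le_trans _ _ n%:R); last by rewrite ler_nat.
  by near: n; exact: nbhs_infty_ger.
suff E : (\int[lebesgue_measure]_x (f x)%:E = 0)%E.
  by rewrite /gauss_int /Rintegral E.
rewrite -(cvg_lim _ cvf) //.
under eq_fun do rewrite intf.
by apply/cvg_lim => //; apply: cvg_EFin => //; exact: nearW.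
Unshelve. all: by end_near.
Qed.

Local Close Scope classical_set_scope.

Lemma hermiteSS (R : realType) n :
  hermite R n.+2 = 'X * hermite R n.+1 - (n.+1%:R / 2) *: hermite R n.
Proof. by []. Qed.

Lemma deriv_hermite (R : realType) n :
  (hermite R n.+1)^`() = n.+1%:R *: hermite R n.
Proof.
suff: (hermite R n.+1)^`() = n.+1%:R *: hermite R n /\
      (hermite R n.+2)^`() = n.+2%:R *: hermite R n.+1 by case.
elim: n => [|n [IH1 IH2]].
  rewrite hermiteSS /=; split; first by rewrite derivX scale1r.
  by rewrite derivB derivM derivZ derivX derivC scaler0 subr0 mul1r mulr1 scaler_nat mulr2n.
split=> //; rewrite hermiteSS derivB derivM derivZ derivX IH1 IH2 mul1r.
rewrite -scalerAr scalerA [hermite R n.+2 in LHS]hermiteSS.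
rewrite [hermite R n.+2 in RHS]hermiteSS -!mul_polyC.
have -> : n.+3%:R = 1 + n.+2%:R :> R by rewrite -natr1 addrC.
rewrite !(polyCD, polyCM, polyC1); ring.
Qed.

Lemma hermiteS (R : realType) n :
  hermite R n.+1 = 'X * hermite R n - 2^-1 *: (hermite R n)^`().
Proof.
case: n => [|n]; first by rewrite /= mulr1 derivC scaler0 subr0.
by rewrite hermiteSS deriv_hermite scalerA [_ / 2]mulrC.
Qed.

Lemma hermite_monic_size (R : realType) n :
  hermite R n \is monic /\ size (hermite R n) = n.+1.
Proof.
elim: n => [|n [mH sH]]; first by rewrite /= monic1 size_poly1.
have sX : size ('X * hermite R n) = n.+2.
  by rewrite mulrC size_mulX ?monic_neq0 // sH.
have sd : (size (- (2^-1 *: (hermite R n)^`())) < n.+2)%N.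
  rewrite size_polyN ltnS (leq_trans (size_scale_leq _ _)) //.
  by rewrite (leq_trans (size_poly _ _)) // sH.
rewrite hermiteS size_polyDl sX //; split=> //.
by rewrite monicE lead_coefDl ?sX // lead_coefM lead_coefX mul1r -monicE.
Qed.

Lemma gauss_int_hermiteM (R : realType) n (q : {poly R}) :
  gauss_int (hermite R n * q) = 2^-1 ^+ n * gauss_int q^`(n).
Proof.
elim: n q => [|n IH] q; first by rewrite /= !mul1r.
have -> : hermite R n.+1 * q = hermite R n * (2^-1 *: q^`())
    + (- 2^-1) *: ((hermite R n * q)^`() - 2 *: 'X * (hermite R n * q)).
  have h : (2^-1)%:P * 2%:P = 1 :> {poly R}.
    by rewrite -polyCM mulVf // pnatr_eq0.
  rewrite hermiteS derivM -!mul_polyC polyCN; ring: h.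
rewrite gauss_intD gauss_intZ gauss_ibp mulr0 addr0 IH derivnZ gauss_intZ.
by rewrite mulrA -exprSr derivSn.
Qed.

Lemma hermite_ops (R : realType) : is_monic_ops (@gauss_form R) (hermite R).
Proof.
split; first exact: hermite_monic_size.
exists (fun n => 2^-1 ^+ n * (n`!%:R * Num.sqrt pi)); split.
  move=> n; rewrite !mulf_neq0 ?expf_neq0 ?invr_eq0 ?pnatr_eq0 -?lt0n ?fact_gt0 //.
  by rewrite gt_eqF // sqrtr_gt0 pi_gt0.
have gE (p q : {poly R}) : gauss_form p q = gauss_int (p * q).
  by apply: eq_Rintegral => x _; rewrite hornerM.
have low n k : (k < n)%N -> gauss_form (hermite R n) (hermite R k) = 0.
  move=> kn; rewrite gE gauss_int_hermiteM derivn_poly0.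
    by rewrite -(scale0r 0) gauss_intZ mul0r mulr0.
  by rewrite (hermite_monic_size R k).2.
move=> n k; case: ltngtP => [nk|kn|<-].
- by rewrite gE mulrC -gE low.
- exact: low.
rewrite gE gauss_int_hermiteM; congr (_ * _).
have [mH sH] := hermite_monic_size R n.
have -> : (hermite R n)^`(n) = n`!%:R *: 1.
  have s1 : (size (hermite R n)^`(n) <= 1)%N.
    by apply/leq_sizeP => j j0; rewrite coef_derivn nth_default ?mul0rn // sH -addn1 leq_add2l.
  rewrite (size1_polyC s1) coef_derivn addn0 ffactnn.
  by move: mH; rewrite monicE lead_coefE sH => /eqP ->; rewrite alg_polyC.
by rewrite gauss_intZ gauss_int1.
Qed.

(* Main.v *)
(* Put [n = m + 2].  By H_(m+1)' = (m+1) H_m and H_m' = 2 (x H_m - H_(m+1)),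
   the span of H_m and H_(m+1) over the polynomials in x is stable under
   differentiation, and by the three-term recurrence it contains
   y = H_(m+2) + lambda H_m.  Expanding y, y' and y'' there, both coordinates of
   the equation cleared of its denominator vanish identically in x, m and
   lambda. *)
Require Import Defs.
From mathcomp Require Import all_boot all_order all_algebra.
From mathcomp Require Import all_classical all_reals all_analysis.
From mathcomp Require Import ring.

Import Order.TTheory GRing.Theory Num.Theory.

Local Open Scope ring_scope.

Lemma deriv_hermite_lower (R : realType) n :
  (hermite R n)^`() = 2 *: ('X * hermite R n - hermite R n.+1).
Proof.
by rewrite hermiteS opprB addrC subrK scalerA divff ?scale1r ?pnatr_eq0.
Qed.

(** The differential equation times [odeR], with the common factor ['X] cancelled: a polynomial
    identity valid for every [l]. *)
Lemma hermite_perturbed_ode (R : realType) (l : R) (m : nat) :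
  let y := hermite R m.+2 + l *: hermite R m in
  odeR l m.+2 * y^`(2)
  - 2 * 'X * (odeR l m.+2 + (2 * l)%:P) * y^`()
  + 2 * (m.+2%:R * odeB l m.+2 - m%:R * l%:P * odeA l m.+2) * y = 0.
Proof.
move=> y.
set h0 := hermite R m; set h1 := hermite R m.+1.
have d0 : h0^`() = 2 *: ('X * h0 - h1) by exact: deriv_hermite_lower.
have d1 : h1^`() = m.+1%:R *: h0 by exact: deriv_hermite.
have y1 : y^`() = m.+2%:R *: h1 + l *: (2 *: ('X * h0 - h1)).
  by rewrite derivD derivZ deriv_hermite -/h0 d0.
have y2 : y^`(2) = m.+2%:R *: (m.+1%:R *: h0)
    + l *: (2 *: (h0 + 'X * (2 *: ('X * h0 - h1)) - m.+1%:R *: h0)).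
  rewrite derivSn derivn1 y1 derivD !derivZ derivB derivM derivX d0 d1.
  by rewrite mul1r.
(* Writing m + 1 = 2k turns the identity into one with integer coefficients,
   which is what [ring] can decide over polynomials. *)
pose k : R := m.+1%:R / 2.
have m1E : m.+1%:R = 2 * k by rewrite /k mulrC divfK ?pnatr_eq0.
have m2E : m.+2%:R = 2 * k + 1 by rewrite -natr1 m1E.
have m0E : m%:R = 2 * k - 1 by rewrite -m1E -natr1 addrK.
have binE : m.+2%:R * (m.+2%:R - 1) / 2 = (2 * k + 1) * k.
  by rewrite m2E; field.
rewrite y2 y1 /y hermiteSS -/h0 -/h1 -/k /odeR /odeB /odeA binE.
rewrite -(polyC_natr R m) -(polyC_natr R m.+2) m0E m1E m2E -!mul_polyC.
rewrite !(polyCB, polyCD, polyCM, polyC1).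
ring.
Qed.

(** [r] times the conclusion is [x] times the hypothesis. *)
Lemma ode_divide (F : fieldType) (x r t q y y1 y2 : F) :
  r != 0 -> r * y2 - 2 * x * (r + t) * y1 + 2 * q * y = 0 ->
  x * y2 - 2 * x ^+ 2 * (1 + t / r) * y1 + 2 * (q / r) * x * y = 0.
Proof.
move=> r0 E; apply: (mulfI r0); rewrite mulr0 -(mulr0 x) -E.
by field.
Qed.

Theorem theorem2p28 (R : realType) (A : R) (S : nat -> {poly R})
    (lambda : nat -> R)
    (hS : is_monic_ops (form2 A) S)
    (hlambda : forall n : nat, (2 <= n)%N ->
       S n = hermite R n + lambda n *: hermite R (n - 2)) :
  forall n : nat, (2 <= n)%N ->
    'X%:F * ((S n)^`(2))%:F
    - 2 * 'X%:F ^+ 2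
      * (1 + (2 * lambda n)%:P%:F / (odeR (lambda n) n)%:F)
      * ((S n)^`())%:F
    + 2 * ((n%:R * (odeB (lambda n) n)%:F
            - (n%:R - 2) * (lambda n)%:P%:F * (odeA (lambda n) n)%:F)
           / (odeR (lambda n) n)%:F)
      * 'X%:F * (S n)%:F
    = 0 :> {fraction {poly R}}.
Proof.
move=> n n2; rewrite (hlambda n n2).
have r0 : (odeR (lambda n) n)%:F != 0 by rewrite tofrac_eq0 odeR_neq0.
apply: ode_divide r0 _.
case: n n2 => [//|[//|m]] _; rewrite subn2 -natrB // subn2.
(* The right-hand 0 becomes the image of the polynomial identity. *)
rewrite -tofrac0.
rewrite -(hermite_perturbed_ode R (lambda m.+2) m).
(* Generalizing keeps the morphism rules from opening these polynomials. *)
rewrite [m.+2.-2]/=; move: (hermite R m.+2 + _) => y.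
move: (odeR _ _) (odeB _ _) (odeA _ _) => r b a.
by rewrite !(tofracN, tofracM, tofracMn, tofrac1, tofracD).
Qed.
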